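(* Let $k\ge 3$ be an integer. Consider the two-player game played on $k$ heaps of tokens (each heap containing finitely many tokens), in which the players alternate moves, a move being either (i) removing a positive number of tokens from each of at least one and at most $k-1$ heaps (possibly emptying them), or (ii) removing the same positive number of tokens from every one of the $k$ heaps; the player making the last move wins. Write a position in standard form $(m_0,\dots,m_{k-1})$ with $0\le m_0\le\dots\le m_{k-1}$, where the $m_i$ are the heap sizes, and let $T_n=\frac12 n(n+1)$ for $n\in\mathbb{Z}_{\ge 0}$. Then the set $\mathcal P$ of $P$-positions of this game is $\mathcal P=\bigcup_{n=0}^{\infty}P_n$, where $$P_n=\Bigl\{(T_n,m_1,\dots,m_{k-1}) : \sum_{i=1}^{k-1}m_i=(k-1)T_n+n,\ T_n\le m_1\le\dots\le m_{k-1}\Bigr\}.$$ That is, the $P$-positions are exactly the positions $(T_n,m_1,\dots,m_{k-1})$ where $(m_1,\dots,m_{k-1})$ ranges over all unordered partitions of $(k-1)T_n+n$ into $k-1$ parts each of size at least $T_n$, for $n\in\mathbb{Z}_{\ge 0}$.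
   Context: A $P$-position is a position from which the previous player (the opponent of the player about to move) can force a win; an $N$-position is one from which the next player (the player about to move) can force a win. $\mathbb{Z}_{\ge 0}$ denotes the nonnegative integers. *)

(* Defs.v *)
From mathcomp Require Import all_boot.

Set Implicit Arguments.
Unset Strict Implicit.
Unset Printing Implicit Defensive.

(* Normal play: a player who cannot move has lost. Inductive (rather than
   coinductive) definitions: a forced win is reached in finitely many moves. *)
Inductive P_position (X : Type) (move : X -> X -> Prop) (p : X) : Prop :=
  | PPosition of (forall q, move p q -> N_position move q)
with N_position (X : Type) (move : X -> X -> Prop) (p : X) : Prop :=
  | NPosition q of move p q & P_position move q.

Definition move_some k (p q : k.-tuple nat) : Prop :=
  (forall i, tnth q i <= tnth p i) /\
  1 <= #|[set i | tnth q i < tnth p i]| <= k - 1.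

Definition move_all k (p q : k.-tuple nat) : Prop :=
  exists t, 0 < t /\ forall i, tnth p i = tnth q i + t.

Definition heap_move k (p q : k.-tuple nat) : Prop :=
  move_some p q \/ move_all p q.

Definition standard_form k (m : k.-tuple nat) : k.-tuple nat :=
  [tuple of sort leq m].

Definition T n := (n * (n + 1)) %/ 2.

(* [path leq (T n) s] reads T n <= s_0 <= s_1 <= ... ; the first equation
   forces s to have k - 1 entries. *)
Definition P_set k n (m : k.-tuple nat) : Prop :=
  exists s : seq nat,
    [/\ tval m = T n :: s,
        \sum_(x <- s) x = (k - 1) * T n + n
      & path leq (T n) s].

(* Main.v *)
Require Import Defs.
From mathcomp Require Import all_boot.
From mathcomp Require Import zify.

(** Call the excess of a position its token total minus [k] times its smallest
    heap; the claimed positions are those with smallest heap [T n] and excess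
    [n], for some [n].

    No move joins two of them.  The total decreases, hence so does the index,
    say from [n] to [n'].  A move of type (ii) preserves the excess; a move of
    type (i) leaves some heap untouched, of size at least [T n], while every
    heap after the move has size at most [T n' + n' < T n'.+1 <= T n].

    Conversely let a position have smallest heap [L] and excess [d].  If
    [T d < L], a move of type (ii) lowers the smallest heap to [T d].  If
    [L < T d], let [T n <= L < T n.+1], so that [n < d]; one can choose a heap to
    lower to [T n] and another one to leave untouched so that the remaining heaps
    can be reduced to total excess [n] over [T n]. *)

Lemma TS n : T n.+1 = T n + n.+1.
Proof.
rewrite /T (_ : n.+1 * (n.+1 + 1) = n * (n + 1) + n.+1 * 2); last by lia.
by rewrite divnDMl.
Qed.

Lemma leq_T m n : m <= n -> T m <= T n.
Proof.
by move=> le_mn; rewrite leq_div2r // leq_mul // leq_add2r.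
Qed.

Lemma T_bracket L : exists n, T n <= L < T n.+1.
Proof.
elim: L => [|L [n /andP[lo hi]]]; first by exists 0.
have [lt|ge] := ltnP L.+1 (T n.+1); first by exists n; rewrite (leqW lo) lt.
by exists n.+1; rewrite ge /= TS; lia.
Qed.

(** Strong induction on [rank], two moves at a time. From a P-position outside [G] one could move
    into [G]; the opponent's winning answer would be a P-position, hence in [G] by induction,
    against closedness. *)
Lemma P_position_char {X : Type} (move : X -> X -> Prop) (rank : X -> nat)
    (G : X -> Prop) :
    (forall p q, move p q -> rank q < rank p) ->
    (forall p q, G p -> move p q -> ~ G q) ->
    (forall p, G p \/ exists2 q, move p q & G q) ->
  forall p, P_position move p <-> G p.
Proof.
move=> rank_lt closed absorbing p.
have [r le_pr] := ubnP (rank p); elim: r => // r IHr in p le_pr *.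
have IH q s : move p q -> move q s -> P_position move s <-> G s.
  move=> /rank_lt lt_qp /rank_lt lt_sq; apply: IHr.
  by move: (rank p) (rank q) (rank s) le_pr lt_qp lt_sq => a b c; lia.
split=> [[Pp]|Gp].
  have [//|[q pq Gq]] := absorbing p.
  case: (Pp q pq) => s qs Ps.
  by case: (closed q s Gq qs); apply/(IH q s pq qs).
constructor=> q pq; have [Gq|[s qs Gs]] := absorbing q.
  by case: (closed p q Gp pq).
by exists s => //; apply/(IH q s pq qs).
Qed.

(** Starting from [f], one unit is removed at a time wherever there is room above [h]; the induction
    is on the surplus [e] of the sum over [n]. *)
Lemma sum_interpolation {I : finType} (h f : I -> nat) n :
    (forall i, h i <= f i) -> \sum_i h i <= n <= \sum_i f i ->
  exists g : I -> nat, (forall i, h i <= g i <= f i) /\ \sum_i g i = n.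
Proof.
move=> le_hf /andP[le_hn]; move En : (\sum_i f i - n) => e.
elim: e f le_hf En => [|e IHe] f le_hf En le_nf.
  by exists f; split=> [i|]; [rewrite le_hf leqnn | lia].
have [i0 lt0] : exists i, h i < f i.
  apply/existsP; case: (boolP [exists i, h i < f i]) => // /existsPn ge.
  have : \sum_i f i <= \sum_i h i by apply: leq_sum => i _; rewrite leqNgt ge.
  by lia.
pose f' i := f i - (i == i0).
have Ef' : \sum_i f i = (\sum_i f' i).+1.
  rewrite (bigD1 i0) // [in RHS](bigD1 i0) //= /f' eqxx -addSn.
  congr (_ + _); first by lia.
  by apply: eq_bigr => i /negbTE->; rewrite subn0.
have [i|||g [le_g Eg]] := IHe f'; [|lia|lia|].
  by rewrite /f'; case: eqP => [->|_]; rewrite ?subn0 //; lia.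
exists g; split=> // i; have /andP[-> le_gf] := le_g i.
by rewrite (leq_trans le_gf) // leq_subr.
Qed.

Lemma sum_reduction {I : finType} (f : I -> nat) j n :
    f j <= n <= \sum_i f i ->
  exists g : I -> nat, [/\ forall i, g i <= f i, g j = f j & \sum_i g i = n].
Proof.
move=> /andP[le_jn le_nf].
(* The lower bound equals [f j] at [j], which forces [g j = f j], and 0 elsewhere. *)
have [i||g [le_g Eg]] :=
    @sum_interpolation _ (fun i => if i == j then f j else 0) f n.
- by case: eqP => [->|].
- by rewrite -big_mkcond big_pred1_eq le_jn.
exists g; split=> // [i|]; first by case/andP: (le_g i).
by have := le_g j; rewrite eqxx -eqn_leq => /eqP.
Qed.

(** An order-free form of [P_set], so that moves can be analysed heap by heap without sorting. *)
Definition triangular_position {k} n (m : k.-tuple nat) :=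
  [/\ forall i, T n <= tnth m i, exists i, tnth m i = T n
    & \sum_i tnth m i = k * T n + n].

Lemma P_set_standard_form k n (m : k.-tuple nat) :
  P_set n (standard_form m) <-> triangular_position n m.
Proof.
have perm_m : perm_eq (sort leq m) m by rewrite perm_sort.
have size_m : size (sort leq m) = k by rewrite size_sort size_tuple.
have sum_m : \sum_(x <- sort leq m) x = \sum_i tnth m i.
  by rewrite (perm_big _ perm_m) big_tuple.
have sorted_m : sorted leq (sort leq m) by apply: sort_sorted; apply: leq_total.
rewrite /P_set /=; split=> [[s [Em Es path_s]]|[ge_m [i Ei] Esum]].
  rewrite Em /= in size_m; rewrite Em big_cons in sum_m.
  split=> [i||].
  - have : tnth m i \in sort leq m by rewrite mem_sort mem_tnth.
    rewrite Em inE => /orP[/eqP->//|].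
    by apply/allP; apply: order_path_min path_s; apply: leq_trans.
  - have /tnthP[i ->] : T n \in m by rewrite -(mem_sort leq) Em mem_head.
    by exists i.
  - by rewrite -sum_m Es -size_m subn1 mulSn addnA.
have T_in : T n \in sort leq m by rewrite mem_sort -Ei mem_tnth.
case Em: (sort leq m) => [|x s] in T_in *; first by [].
rewrite Em /= in size_m sorted_m; rewrite Em big_cons in sum_m.
have Ex : x = T n.
  apply/eqP; rewrite eqn_leq; apply/andP; split.
    move: T_in; rewrite inE => /orP[/eqP->//|].
    by apply/allP; apply: order_path_min sorted_m; apply: leq_trans.
  have /tnthP[j ->] : x \in m by rewrite -(mem_sort leq) Em mem_head.
  exact: ge_m.
exists s; split; rewrite -?Ex //.
by move: sum_m; rewrite Esum -size_m subn1 -Ex mulSn -addnA; apply: addnI.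
Qed.

Lemma heap_move_sum k (p q : k.-tuple nat) :
  0 < k -> heap_move p q -> \sum_i tnth q i < \sum_i tnth p i.
Proof.
move=> k_gt0 [[le_qp /andP[/card_gt0P[i]]]|[t [t_gt0 Ep]]].
  rewrite inE => lt_i _; rewrite (bigD1 i) //= [ltnRHS](bigD1 i) //=.
  by rewrite -addSn leq_add // leq_sum.
rewrite (eq_bigr _ (fun i _ => Ep i)) big_split /= sum_nat_const card_ord.
by rewrite -[ltnLHS]addn0 ltn_add2l muln_gt0 k_gt0.
Qed.

Lemma triangular_position_le k n (m : k.-tuple nat) i :
  triangular_position n m -> tnth m i <= T n + n.
Proof.
case=> ge_m _; rewrite (bigD1 i) //=.
have : \sum_(j | j != i) T n <= \sum_(j | j != i) tnth m j by apply: leq_sum.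
have := cardC1 i; rewrite sum_nat_const /= card_ord => ->.
by case: k i m ge_m => [[]//|k] i m _; rewrite mulSn /=; lia.
Qed.

Lemma triangular_position_closed k (p q : k.-tuple nat) n n' :
    0 < k -> heap_move p q ->
  triangular_position n p -> ~ triangular_position n' q.
Proof.
move=> k_gt0 pq tri_p tri_q; have := heap_move_sum _ _ _ k_gt0 pq.
have [ge_p [ip Eip] Esp] := tri_p; have [ge_q [iq Eiq] Esq] := tri_q.
rewrite Esp Esq => lt_sum.
have lt_n : n' < n.
  rewrite ltnNge; apply/negP => le_n; move: lt_sum; rewrite ltnNge => /negP[].
  by rewrite leq_add // leq_mul2l leq_T ?orbT.
case: pq => [[le_qp /andP[_ card_le]]|[t [t_gt0 Ep]]].
  have [i lt_iN] : exists i, ~~ (tnth q i < tnth p i).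
    apply/existsP; rewrite -negb_forall; apply/negP => /forallP lt_qp.
    move: card_le; rewrite (_ : [set i | _] = setT); last first.
      by apply/setP => i; rewrite !inE lt_qp.
    by rewrite cardsT card_ord; lia.
  have := triangular_position_le _ _ _ i tri_q; have := ge_p i.
  by have := leq_T _ _ lt_n; rewrite TS; lia.
(* Subtracting [t] everywhere lowers the minimum by [t]; comparing totals then gives [n = n']. *)
have ET : T n = T n' + t.
  apply/eqP; rewrite eqn_leq -{1}Eiq -Ep ge_p /=.
  by rewrite -Eip Ep leq_add2r ge_q.
move: Esp; rewrite (eq_bigr _ (fun i _ => Ep i)) big_split /= sum_nat_const.
by rewrite card_ord Esq ET mulnDr addnAC => /addnI; lia.
Qed.

(** Here [f] stands for heap sizes above [T n]: heap [z] is to be emptied and heap [j] kept. The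
    equation on [f j] allows [z = j] only when that heap is already empty. *)
Lemma exists_zeroed_and_kept {I : finType} (f : I -> nat) (i0 : I) n :
    2 < #|I| -> (forall i, f i0 <= f i) -> f i0 <= n ->
    n + #|I| * f i0 <= \sum_i f i ->
  exists z j, f j = (if j == z then 0 else f j) /\
    f j <= n <= \sum_i (if i == z then 0 else f i).
Proof.
move=> card_gt2 f_min le_n le_sum.
have sumz z : \sum_i (if i == z then 0 else f i) = \sum_(i | i != z) f i.
  by rewrite [RHS]big_mkcond /=; apply: eq_bigr => i _; case: eqP.
have [f0|f_gt0] := posnP (f i0).
  exists i0, i0; rewrite eqxx sumz; split=> //.
  by move: le_sum; rewrite (bigD1 i0) //= f0; lia.
(* If a heap other than the smallest fits within [n], keep it and empty the smallest. *)
case: (boolP [exists j, (j != i0) && (f j <= n)]) => [/existsP[j /andP[nj le_j]]|].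
  exists i0, j; rewrite (negbTE nj) sumz le_j; split=> //.
  have : 1 * f i0 <= #|I| * f i0 by rewrite leq_mul2r (ltnW (ltnW card_gt2)) orbT.
  by move: le_sum; rewrite (bigD1 i0) //=; lia.
(* Otherwise keep the smallest and empty any other heap [z]; a third heap [w] alone exceeds [n]. *)
move=> /existsPn gt_n.
have [z nz] : exists z, z != i0.
  apply/existsP; apply: contraTT card_gt2 => /existsPn eq0.
  by rewrite -leqNgt (leq_trans (subset_leq_card _) (leqW (eq_leq (card1 i0)))) //;
     apply/subsetP => i _; rewrite inE; have := eq0 i; rewrite negbK.
have [w /andP[wz w0]] : exists w, (w != z) && (w != i0).
  apply/existsP; apply: contraTT card_gt2 => /existsPn eq0.
  have := subset_leq_card (A := I) (B := [set z; i0]); rewrite cards2 nz -leqNgt.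
  by apply; apply/subsetP => i _; rewrite !inE; have := eq0 i; rewrite negb_and !negbK.
exists z, i0; rewrite eq_sym (negbTE nz) sumz le_n; split=> //.
by rewrite (bigD1 w) //=; have := gt_n w; rewrite w0 /=; lia.
Qed.

Lemma triangular_position_absorbing k (p : k.-tuple nat) : 2 < k ->
  (exists n, triangular_position n p) \/
  exists2 q, heap_move p q & exists n, triangular_position n q.
Proof.
move=> k_gt2; have k_gt0 : 0 < k by lia.
have [i0 _ p_min] := @arg_minnP _ (Ordinal k_gt0) xpredT (tnth p) isT.
have {}p_min i : tnth p i0 <= tnth p i by apply: p_min.
have sum_sub c : c <= tnth p i0 ->
    \sum_i tnth p i = k * c + \sum_i (tnth p i - c).
  move=> le_c; rewrite -[X in X * c]card_ord -sum_nat_const -big_split /=.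
  by apply: eq_bigr => i _; rewrite subnKC // (leq_trans le_c).
have := sum_sub _ (leqnn _); set L := tnth p i0 in p_min sum_sub *.
move: (\sum_i (_ - L)) => d Ed.
have [lt_Td|lt_L|ET] := ltngtP (T d) L; last first.
- by left; exists d; split; rewrite ?ET //; exists i0.
- right; have [n /andP[le_Tn lt_LT]] := T_bracket L.
  have lt_nd : n < d.
    by rewrite ltnNge; apply/negP => /leq_T; lia.
  pose f i := tnth p i - T n.
  have sum_f : \sum_i f i = k * (L - T n) + d.
    have := sum_sub _ le_Tn; rewrite Ed mulnBr.
    by have : k * T n <= k * L by [rewrite leq_mul2l le_Tn orbT]; rewrite /f; lia.
  (* The bound [f i0 <= n] comes from [L < T n.+1], and the bound on the sum from [n < d]. *)
  have [|i|||z [j [fj bounds]]] := @exists_zeroed_and_kept _ f i0 n; rewrite ?card_ord //.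
  + by rewrite leq_sub2r.
  + by rewrite /f -/L; move: lt_LT; rewrite TS; lia.
  + by rewrite sum_f /f -/L; lia.
  have [|g [le_g gj sum_g]] := @sum_reduction _ (fun i => if i == z then 0 else f i) j n.
    by rewrite -fj.
  have {}gj : g j = f j by rewrite gj -fj.
  have gz : g z = 0 by apply/eqP; have := le_g z; rewrite eqxx leqn0.
  have {}le_g i : g i <= f i by apply: leq_trans (le_g i) _; case: eqP.
  pose q := [tuple T n + g i | i < k].
  have qE i : tnth q i = T n + g i by rewrite tnth_mktuple.
  have pE i : tnth p i = T n + f i by rewrite subnKC // (leq_trans le_Tn).
  exists q; last first.
    exists n; split=> [i||]; first by rewrite qE leq_addr.
      by exists z; rewrite qE gz addn0.
    rewrite (eq_bigr _ (fun i _ => qE i)) big_split /= sum_g sum_nat_const.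
    by rewrite card_ord.
  left; split=> [i|]; first by rewrite qE pE leq_add2l.
  apply/andP; split.
    (* Some heap really shrinks, since the sum of [g] is [n < d], while that of [f] is at least
       [d]. *)
    apply/card_gt0P; case: (boolP [exists i, g i < f i]) => [/existsP[i lt_i]|].
      by exists i; rewrite inE qE pE ltn_add2l.
    move=> /existsPn ge; suff : \sum_i f i <= \sum_i g i by rewrite sum_f sum_g; lia.
    by apply: leq_sum => i _; rewrite leqNgt ge.
  have /subset_leq_card : [set i | tnth q i < tnth p i] \subset [set~ j].
    apply/subsetP => i; rewrite !inE qE pE ltn_add2l.
    by apply: contraTneq => ->; rewrite gj ltnn.
  by rewrite cardsC1 card_ord subn1.
right; pose q := [tuple tnth p i - (L - T d) | i < k].
have qE i : tnth p i = tnth q i + (L - T d).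
  by rewrite tnth_mktuple; have := p_min i; lia.
exists q; first by right; exists (L - T d); rewrite subn_gt0.
exists d; split=> [i||].
- by have := p_min i; rewrite qE; lia.
- by exists i0; have := qE i0; rewrite -/L; lia.
move: Ed; rewrite (eq_bigr _ (fun i _ => qE i)) big_split /= sum_nat_const.
rewrite card_ord mulnBr.
have : k * T d <= k * L by rewrite leq_mul2l (ltnW lt_Td) orbT.
by lia.
Qed.

Theorem theorem1 (k : nat) (hk : 3 <= k) (m : k.-tuple nat) :
  P_position (@heap_move k) m <-> exists n : nat, P_set n (standard_form m).
Proof.
have k_gt0 : 0 < k by apply: leq_trans hk.
have -> : (exists n, P_set n (standard_form m)) <->
          (exists n, triangular_position n m).
  by split=> -[n /P_set_standard_form ?]; exists n.
apply: (@P_position_char _ _ (fun p : k.-tuple nat => \sum_i tnth p i)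
          (fun p => exists n, triangular_position n p)) => [p q|p q [n tri_p] pq [n']|p].
- exact: heap_move_sum.
- exact: (triangular_position_closed _ p q n n' k_gt0 pq tri_p).
- exact: triangular_position_absorbing.
Qed.
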